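(* Let $K$ be a natural number, $l>0$, and let $g:F_{\omega,K}\to l$ be a Suslin measurable coloring. Then there exists $(r,c)\in F_{\omega,\omega}$ such that $[(r,c)]_K=\{(s,j)\cdot(r,c):(s,j)\in F_{\omega,K}\}$ is monochromatic for $g$.
   Context: Conventions: $\omega=\{0,1,2,\dots\}$, each natural number $n$ is identified with $\{0,\dots,n-1\}$. For $K\le L\le\omega$, $F_{L,K}$ is the set of pairs $(r,c)$ with $r:L\to K$, $c:K\to L$ strictly increasing, such that for all $x\in K$, $y\in L$: $r(c(x))=x$, and $y\le c(x)\Rightarrow r(y)\le x$. Composition: $(s,j)\cdot(r,c)=(s\circ r,\,c\circ j)\in F_{M,K}$ for $(s,j)\in F_{L,K}$, $(r,c)\in F_{M,L}$. $F_{\omega,K}$ carries the topology whose basic open sets are $\{(s,j)\in F_{\omega,K}: s\upharpoonright L=t,\ j=i\}$ for $(t,i)\in F_{L,K}$, $L<\omega$. A map $g$ from a topological space $X$ into a finite discrete space is Suslin measurable if the preimage of every subset belongs to the smallest $\sigma$-field of subsets of $X$ containing the closed sets and closed under the Suslin operation. *)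

(* Defs.v *)
From HB Require Import structures.
From mathcomp Require Import all_boot all_order.
From mathcomp Require Import all_classical.
From mathcomp Require Import topology measurable_structure.

Set Implicit Arguments.
Unset Strict Implicit.
Unset Printing Implicit Defensive.

Local Open Scope classical_set_scope.
Local Open Scope order_scope.

(* The set F_{L,K} for K <= L <= omega, where a natural number n is the ordered
   type 'I_n and omega is nat.  K <= L need not be required: a strictly
   increasing map K -> L exists only in that case. *)
Record rigid {dL dK : Order.disp_t} (L : orderType dL) (K : orderType dK) :=
  Rigid {
    rsurj : L -> K;
    rsect : K -> L;
    rsect_homo : {homo rsect : x y / x < y};
    rsectK : forall x : K, rsurj (rsect x) = x;
    rsurj_le : forall (x : K) (y : L), y <= rsect x -> rsurj y <= x
  }.

Section Comp.
Context {dM dL dK : Order.disp_t}.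
Context {M : orderType dM} {L : orderType dL} {K : orderType dK}.
Variables (f : rigid L K) (h : rigid M L).

Lemma rcomp_homo : {homo rsect h \o rsect f : x y / x < y}.
Proof. by move=> x y xy /=; do 2! apply: rsect_homo. Qed.

Lemma rcompK (x : K) : (rsurj f \o rsurj h) ((rsect h \o rsect f) x) = x.
Proof. by rewrite /= !rsectK. Qed.

Lemma rcomp_le (x : K) (y : M) :
  y <= (rsect h \o rsect f) x -> (rsurj f \o rsurj h) y <= x.
Proof. by move=> /= /rsurj_le /rsurj_le. Qed.

Definition rcomp : rigid M K := Rigid rcomp_homo rcompK rcomp_le.

End Comp.

(* [h]_K *)
Definition pullbacks {dM dL : Order.disp_t} {M : orderType dM}
    {L : orderType dL} (h : rigid M L) (K : nat) : set (rigid M 'I_K) :=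
  range (fun f : rigid L 'I_K => rcomp f h).
Arguments pullbacks {dM dL M L} h K _.

HB.instance Definition _ (dL dK : Order.disp_t) (L : orderType dL)
  (K : orderType dK) := gen_eqMixin (rigid L K).
HB.instance Definition _ (dL dK : Order.disp_t) (L : orderType dL)
  (K : orderType dK) := gen_choiceMixin (rigid L K).

Section Topology.
Variable K : nat.

Definition basic_open (L : nat) (t : rigid 'I_L 'I_K) : set (rigid nat 'I_K) :=
  [set f | (forall y : 'I_L, rsurj f (y : nat) = rsurj t y) /\
           (forall x : 'I_K, rsect f x = rsect t x :> nat)].

Definition rigid_open : set_system (rigid nat 'I_K) :=
  [set U | forall f, U f ->
     exists (L : nat) (t : rigid 'I_L 'I_K),
       basic_open t f /\ basic_open t `<=` U].

Lemma basic_open_exists (f : rigid nat 'I_K) :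
  exists (L : nat) (t : rigid 'I_L 'I_K), basic_open t f.
Proof.
pose L := (\max_(x < K) rsect f x).+1.
have ltL (x : 'I_K) : (rsect f x < L)%N.
  by rewrite ltnS; apply: (leq_bigmax x).
pose r (y : 'I_L) := rsurj f (y : nat).
pose c (x : 'I_K) := Ordinal (ltL x).
have ch : {homo c : x y / x < y} by move=> x y; apply: rsect_homo.
have rK x : r (c x) = x by apply: rsectK.
have rc x (y : 'I_L) : y <= c x -> r y <= x by apply: rsurj_le.
by exists L, (Rigid ch rK rc).
Qed.

Lemma rigid_openT : rigid_open setT.
Proof. by move=> f _; have [L [t ft]] := basic_open_exists f; exists L, t. Qed.

Lemma rigid_openI : setI_closed rigid_open.
Proof.
have le L1 L2 (t1 : rigid 'I_L1 'I_K) (t2 : rigid 'I_L2 'I_K) f :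
    (L1 <= L2)%N -> basic_open t1 f -> basic_open t2 f ->
    basic_open t2 `<=` basic_open t1.
  move=> L12 [r1 c1] [r2 c2] h [r3 c3]; split=> [y|x].
    have := r3 (widen_ord L12 y); rewrite -r2 /= => ->.
    exact: r1.
  by rewrite c3 -c2 c1.
move=> U V oU oV f [/oU[L1 [t1 [f1 s1]]] /oV[L2 [t2 [f2 s2]]]].
case: (leqP L1 L2) => [|/ltnW] L12.
  exists L2, t2; split=> // h h2; split; last exact: s2.
  exact/s1/(le _ _ _ _ f L12 f1 f2 h h2).
exists L1, t1; split=> // h h1; split; first exact: s1.
exact/s2/(le _ _ _ _ f L12 f2 f1 h h1).
Qed.

Lemma rigid_open_bigU (I : Type) (U : I -> set (rigid nat 'I_K)) :
  (forall i, rigid_open (U i)) -> rigid_open (\bigcup_i U i).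
Proof.
move=> oU f [i _ /oU[L [t [ft tU]]]]; exists L, t; split=> // h /tU Uh.
by exists i.
Qed.

HB.instance Definition _ := @isOpenTopological.Build (rigid nat 'I_K)
  rigid_open rigid_openT rigid_openI rigid_open_bigU.

Lemma rigid_openE (U : set (rigid nat 'I_K)) : open U <-> rigid_open U.
Proof.
rewrite openE; split=> oU f Uf.
  have [V [oV Vf VU]] := oU _ Uf; have [L [t [ft tV]]] := oV _ Vf.
  by exists L, t; split=> //; apply: subset_trans VU.
by exists U; split.
Qed.

End Topology.

Section Suslin.
Context {X : Type}.

Definition suslin_op (A : seq nat -> set X) : set X :=
  \bigcup_(u in [set: nat -> nat]) \bigcap_(n in [set: nat]) A (mkseq u n).

Definition suslin_closed (S : set_system X) :=
  forall A : seq nat -> set X, (forall s, S (A s)) -> S (suslin_op A).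

End Suslin.

Definition suslin_sigma (X : topologicalType) : set_system X :=
  smallest [set S | sigma_algebra setT S /\ suslin_closed S] closed.

(* The finite discrete codomain is only used through its subsets. *)
Definition suslin_measurable {X : topologicalType} {T : Type} (g : X -> T) :=
  forall Y : set T, suslin_sigma (g @^-1` Y).

Definition monochromatic {X T : Type} (g : X -> T) (A : set X) :=
  exists a : T, forall x, A x -> g x = a.

(* Main.v *)
(** An element (r, c) of F_{omega,omega} is an infinite word in the variables
    0, 1, 2, ..., first occurring in this order, with a marked occurrence of
    each n before the first one of n + 1; composition is substitution.

    A minimal idempotent p on the words over K letters and a minimal idempotent
    q <= p on the words over K + 1 letters satisfy T_a q = p for every
    substitution T_a of a letter a < K for the last letter K, and, as
    q (beta M) q is a group with unit q, q [K] y = q for some y. As in the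
    Galvin-Glazer argument this gives blocks v'_m K v''_m such that a colouring
    of words is constant on all the
    T_{a_0}(v'_0 K v''_0) ... T_{a_{m-1}}(v'_{m-1} K v''_{m-1}) v'_m, that is,
    on the last part of the words cut at their last mark. By fusion and
    induction on K, every finite colouring of the K-words cut at their last mark
    is constant after composition with a suitable element of F_{omega,omega}.

    A Suslin measurable set has the property of Baire, since the Suslin
    operation preserves it (Nikodym). Hence, by a second fusion, one may assume
    that the colour of an element of F_{omega,K} depends only on its part up to
    the last mark, the part after it ranging over a Cantor space. *)

Require Import Defs.
From mathcomp Require Import all_boot all_order.
From mathcomp Require Import all_classical.
From mathcomp Require Import topology measurable_structure.
From mathcomp Require Import zify.

Set Implicit Arguments.
Unset Strict Implicit.
Unset Printing Implicit Defensive.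

Local Open Scope classical_set_scope.

(** * Minimal idempotent ultrafilters *)

Section UltrafilterSemigroup.
Variable T : Type.
Local Notation M := (seq T).
Implicit Types (F G L N p q r u : set_system M) (A B : set M).

Definition lquot (s : M) A : set M := [set t | A (s ++ t)].

(** The extension of concatenation to ultrafilters. It takes arbitrary set systems because a closed
    set of ultrafilters is represented below by a filter contained in all its members; a larger
    filter means a smaller closed set. *)
Definition pmul F G : set_system M := [set A | F [set s | G (lquot s A)]].

Lemma lquot_cat s t A : lquot (s ++ t) A = lquot t (lquot s A).
Proof. by apply/funext => x; rewrite /lquot /= catA. Qed.

Lemma pmulA F G L : pmul F (pmul G L) = pmul (pmul F G) L.
Proof.
apply/funext => A; rewrite /pmul /=; congr F; apply/funext => s /=.
by congr (G _); apply/funext => t; rewrite /mkset -lquot_cat.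
Qed.

Lemma pmul_filter F G : ProperFilter F -> ProperFilter G ->
  ProperFilter (pmul F G).
Proof.
move=> PF PG; split.
  rewrite /pmul /= => F0; apply: (@filter_not_empty _ F).
  by apply: filterS F0 => s; apply: filter_not_empty.
split.
- by apply: (@filterS _ F _ setT); [move=> s _; apply: filterT|apply: filterT].
- by move=> A B; apply: (@filterS2 _ F) => s GA GB; apply: (filterI GA GB).
- by move=> A B AB; apply: (@filterS _ F) => s; apply: filterS => t; apply: AB.
Qed.

Lemma ultraP F : ProperFilter F -> (forall A, F A \/ F (~` A)) -> UltraFilter F.
Proof.
move=> PF FC; split=> // G PG FG; apply/seteqP; split=> // A GA.
case: (FC A) => // /FG GnA.
by have /filter_ex[x []] : G (A `&` ~` A) by exact: filterI.
Qed.

Lemma pmul_ultra p q : UltraFilter p -> UltraFilter q -> UltraFilter (pmul p q).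
Proof.
move=> Up Uq; apply: ultraP; first exact: pmul_filter.
move=> A; have [pA|pA] := in_ultra_setVsetC [set s | q (lquot s A)] Up.
  by left.
right; apply: filterS pA => s /= nq.
by have [//|] := in_ultra_setVsetC (lquot s A) Uq.
Qed.

Lemma ultra_eq p q : UltraFilter p -> UltraFilter q -> p `<=` q -> p = q.
Proof. by move=> Up Uq pq; apply/esym; apply: max_filter. Qed.

Lemma ultra_setC p A : UltraFilter p -> ~ p A -> p (~` A).
Proof. by move=> Up nA; have [] := in_ultra_setVsetC A Up. Qed.

Lemma proper_setC p A : ProperFilter p -> p A -> ~ p (~` A).
Proof.
move=> PF pA pnA.
by have /filter_ex[x []] : p (A `&` ~` A) by exact: filterI.
Qed.

Lemma ultra_ext F (S : set_system M) : ProperFilter F ->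
  S setT -> (forall A B, S A -> S B -> S (A `&` B)) ->
  (forall A B, F A -> S B -> exists x, (A `&` B) x) ->
  exists p, [/\ UltraFilter p, F `<=` p & S `<=` p].
Proof.
move=> PF ST SI SN.
pose G : set_system M := [set C | exists A B, [/\ F A, S B & A `&` B `<=` C]].
have PG : ProperFilter G.
  apply: Build_ProperFilter_ex.
    by move=> C [A [B [FA SB ABC]]]; have [x /ABC] := SN _ _ FA SB; exists x.
  split.
  - by exists setT, setT; split=> //; apply: filterT.
  - move=> C C' [A [B [FA SB ABC]]] [A' [B' [FA' SB' ABC']]].
    exists (A `&` A'), (B `&` B'); split; [exact: filterI|exact: SI|].
    by move=> x [[? ?] [? ?]]; split; [apply: ABC|apply: ABC'].
  - move=> C C' CC' [A [B [FA SB ABC]]]; exists A, B; split=> //.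
    exact: subset_trans CC'.
have [p [Up Gp]] := ultraFilterLemma PG; exists p; split=> // A.
- by move=> FA; apply: Gp; exists A, setT; split=> // x [].
- by move=> SA; apply: Gp; exists setT, A; split=> [||x []]; first exact: filterT.
Qed.

(** Otherwise some ultrafilter contains both [F] and the complement of [A]. Inclusions between
    closed sets of ultrafilters can thus be checked on their points. *)
Lemma filter_sep F A : ProperFilter F ->
  (forall p, UltraFilter p -> F `<=` p -> p A) -> F A.
Proof.
move=> PF FA; apply: contrapT => nFA.
have [|||p [Up Fp Sp]] :=
  @ultra_ext F [set B | ~` A `<=` B] PF.
- by [].
- by move=> B C AB hC x nA; split; [apply: AB|apply: hC].
- move=> B C FB hC; apply: contrapT => nex; apply: nFA.
  apply: filterS FB => x Bx; apply: contrapT => nAx; apply: nex.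
  by exists x; split=> //; apply: hC.
- by apply: (@proper_setC p A); [exact: FA|exact: Sp].
Qed.

(* The closed set of ultrafilters containing F is mapped by right
   multiplication by p onto the one given by [pmul F p]. *)
Lemma pmul_closed F p r : ProperFilter F -> UltraFilter p -> UltraFilter r ->
  pmul F p `<=` r -> exists q, [/\ UltraFilter q, F `<=` q & pmul q p = r].
Proof.
move=> PF Up Ur Fpr.
have [|||q [Uq Fq Sq]] := @ultra_ext F
  [set B | exists2 A, r A & B = [set s | p (lquot s A)]] PF.
- exists setT; first exact: filterT.
  by apply/seteqP; split=> // s _; apply: filterT.
- move=> B C [A rA ->] [A' rA' ->]; exists (A `&` A'); first exact: filterI.
  apply/seteqP; split=> [s [? ?]|s ps]; first exact: filterI.
  by split; apply: filterS ps => t [].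
- move=> B C FB [A rA ->]; apply: contrapT => nex.
  apply: (proper_setC _ rA); apply: Fpr; apply: filterS FB => s Bs.
  apply: ultra_setC => pA; apply: nex; by exists s.
- exists q; split=> //; apply/esym; apply: ultra_eq => [|A rA].
    exact: pmul_ultra.
  by apply: Sq; exists A.
Qed.

Lemma zorn_system (P : set (set_system M)) F0 : P F0 -> F0 !=set0 ->
  (forall C : set (set_system M), C `<=` P -> C !=set0 -> total_on C subset ->
     P (\bigcup_(F in C) F)) ->
  exists F, [/\ P F, F0 `<=` F & forall G, P G -> F `<=` G -> G = F].
Proof.
move=> PF0 [A0 FA0] Pchain.
pose Q F := F = set0 \/ (P F /\ F0 `<=` F).
have [C CQ Ctot|F [QF Fmax]] := @Zorn_bigcup _ Q.
  have [[F [CF [PF F0F]]]|nC] :=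
    pselect (exists F, C F /\ (P F /\ F0 `<=` F)); last first.
    left; apply/seteqP; split=> // A [F CF FA]; case: (CQ _ CF) => [F0'|PF].
      by rewrite -F0'.
    by case: nC; exists F.
  right; pose C' := [set F | C F /\ (P F /\ F0 `<=` F)].
  have -> : \bigcup_(F in C) F = \bigcup_(F in C') F.
    apply/seteqP; split=> A [G CG GA]; last by exists G => //; case: CG.
    by exists G => //; split=> //; case: (CQ _ CG) => // G0; rewrite G0 in GA.
  split; last by move=> A /F0F FA; exists F.
  apply: Pchain => [G [_ []] //||].
    by exists F.
  by move=> G H [CG _] [CH _]; apply: Ctot.
have [PF F0F] : P F /\ F0 `<=` F.
  case: QF => // F_0; exfalso; apply: (Fmax F0); last by right; split.
  by rewrite F_0; split=> [|/(_ _ FA0)]; first exact: sub0set.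
exists F; split=> // G PG FG; apply: contrapT => GF; apply: (Fmax G).
  by split=> // GF'; apply: GF; apply/seteqP.
right; split=> //; exact: subset_trans FG.
Qed.

Lemma chain_filter (C : set (set_system M)) :
  (forall F, C F -> ProperFilter F) -> C !=set0 -> total_on C subset ->
  ProperFilter (\bigcup_(F in C) F).
Proof.
move=> PC [F0 CF0] Ctot; apply: Build_ProperFilter_ex.
  by move=> A [F /PC PF FA]; exact: (@filter_ex _ _ PF).
split.
- by exists F0 => //; have := PC _ CF0 => ?; apply: filterT.
- move=> A B [F CF FA] [G CG GB]; have PF := PC _ CF; have PG := PC _ CG.
  by case: (Ctot _ _ CF CG) => FG; [exists G|exists F] => //;
    apply: filterI => //; apply: FG.
- move=> A B AB [F CF FA]; have PF := PC _ CF; exists F => //.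
  exact: filterS FA.
Qed.

(** [F] represents a closed subsemigroup. *)
Definition semigroup_filter F := forall q r, UltraFilter q -> UltraFilter r ->
  F `<=` q -> F `<=` r -> F `<=` pmul q r.

(** The Ellis-Numakura argument: a maximal filter [N] of this kind represents a minimal closed
    subsemigroup, and any [p] in it is idempotent. *)
Lemma ellis L : ProperFilter L -> semigroup_filter L ->
  exists e, [/\ UltraFilter e, L `<=` e & pmul e e = e].
Proof.
move=> PL SL.
have [|||N [[PN SN] LN Nmax]] :=
  @zorn_system [set F | ProperFilter F /\ semigroup_filter F] L.
- by [].
- by exists setT; apply: filterT.
- move=> C CP C0 Ctot; split; first by apply: chain_filter => // F /CP[].
  move=> q r Uq Ur Cq Cr A [F CF FA].
  have [_ SF] := CP _ CF; apply: (SF q r Uq Ur) => // B FB.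
    by apply: Cq; exists F.
  by apply: Cr; exists F.
have [p [Up Np]] := ultraFilterLemma PN.
(* The right translate by [p] is a closed subsemigroup inside the minimal one, hence equal to it; so
   [q p = p] has a solution there. *)
have Npp : pmul N p = N.
  apply: Nmax; last first.
    move=> A NA; apply: (filter_sep PN) => q Uq Nq; exact: (SN q p).
  split; first exact: pmul_filter.
  move=> q r Uq Ur /(pmul_closed PN Up Uq)[q' [Uq' Nq' <-]].
  move=> /(pmul_closed PN Up Ur)[r' [Ur' Nr' <-]].
  rewrite pmulA => A NA.
  have Uz : UltraFilter (pmul (pmul q' p) r').
    by apply: pmul_ultra => //; apply: pmul_ultra.
  have Nz : N `<=` pmul (pmul q' p) r'.
    exact: (SN _ _ (pmul_ultra Uq' Up) Ur' (SN _ _ Uq' Up Nq' Np) Nr').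
  exact: Nz.
have [q [Uq Nq qp]] : exists q, [/\ UltraFilter q, N `<=` q & pmul q p = p].
  by apply: pmul_closed => //; rewrite Npp.
(* [S] represents the solutions [r] of [r p = p]. They form a closed subsemigroup, hence the whole
   minimal one, to which [p] belongs. *)
pose S : set_system M := [set B | exists X A, [/\ N X, p A &
  X `&` [set s | p (lquot s A)] `<=` B]].
have Sq r : UltraFilter r -> S `<=` r -> N `<=` r /\ pmul r p = p.
  move=> Ur Sr; split.
    move=> X NX; apply: Sr; exists X, setT; split=> [||x []] //; exact: filterT.
  apply/esym; apply: ultra_eq => [|A pA]; first exact: pmul_ultra.
  apply: Sr; exists setT, A; split=> [||x []] //; exact: filterT.
have qS r : UltraFilter r -> N `<=` r -> pmul r p = p -> S `<=` r.
  move=> Ur Nr rp B [X [A [NX pA XAB]]]; apply: filterS XAB _.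
  by apply: filterI; [exact: Nr|rewrite -rp in pA].
have SS : S = N.
  apply: Nmax; last by move=> A NA; exists A, setT; split=> [||x []] //;
    exact: filterT.
  split; last first.
    move=> r r' Ur Ur' /(Sq r Ur)[Nr rp] /(Sq r' Ur')[Nr' rp'].
    apply: qS; [exact: pmul_ultra|exact: SN|by rewrite -pmulA rp'].
  have Sq' := qS q Uq Nq qp.
  split; first by move/Sq'; apply: filter_not_empty.
  split.
  - by exists setT, setT; split=> //; exact: filterT.
  - move=> B B' [X [A [NX pA XAB]]] [X' [A' [NX' pA' XAB']]].
    exists (X `&` X'), (A `&` A'); split; [exact: filterI|exact: filterI|].
    move=> s [[Xs Xs'] ps]; split; [apply: XAB|apply: XAB']; split=> //.
      by apply: filterS ps => t [].
    by apply: filterS ps => t [].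
  - move=> B B' BB' [X [A [NX pA XAB]]]; exists X, A; split=> //.
    exact: subset_trans BB'.
by exists p; split=> //; [exact: subset_trans Np|apply: (Sq p Up _).2; rewrite SS].
Qed.

Definition on (D : set M) p := UltraFilter p /\ p D.

Section Minimal.
Variable D : set M.
Hypothesis D0 : D [::].
Hypothesis Dcat : forall s t, D s -> D t -> D (s ++ t).

Lemma pmul_on p q : on D p -> on D q -> on D (pmul p q).
Proof.
move=> [Up pD] [Uq qD]; split; first exact: pmul_ultra.
by apply: filterS pD => s Ds; apply: filterS qD => t; apply: Dcat.
Qed.

(** The closed set represented by [F] is stable under left multiplication by words of [D], hence by
    all ultrafilters on [D]. *)
Definition left_ideal F := forall A m, F A -> D m -> F (lquot m A).

(** A minimal closed left ideal among the multiples of [p] contains an idempotent [e]. Since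
    [e p = e], the product [p e] is an idempotent below [p]; the last clause comes from the
    minimality of the ideal. *)
Lemma min_idempotent p : on D p -> pmul p p = p ->
  exists q, [/\ on D q, pmul q q = q, pmul p q = q, pmul q p = q &
    forall u, on D u -> exists2 y, on D y & pmul y (pmul u q) = q].
Proof.
move=> [Up pD] pp.
(* [GD] represents all ultrafilters on [D], and [pmul GD p] the left ideal of their products with
   [p]. *)
pose GD : set_system M := [set A | D `<=` A].
have PGD : ProperFilter GD.
  split; first by move/(_ [::] D0).
  split=> //; first by move=> A B DA DB x Dx; split; [apply: DA|apply: DB].
  by move=> A B AB DA; apply: subset_trans AB.
have GDideal r : UltraFilter r -> left_ideal (pmul GD r).
  move=> Ur A m GA Dm s Ds; have := GA _ (Dcat Dm Ds).
  by rewrite /= lquot_cat.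
have [|||L [[PL IL] GL Lmax]] :=
  @zorn_system [set F | ProperFilter F /\ left_ideal F] (pmul GD p).
- by split; [exact: pmul_filter|exact: GDideal].
- by exists setT => s _; apply: filterT.
- move=> C CP C0 Ctot; split; first by apply: chain_filter => // F /CP[].
  move=> A m [F CF FA] Dm; exists F => //.
  by have [_] := CP _ CF; apply.
have ucl u r : on D u -> UltraFilter r -> L `<=` r -> L `<=` pmul u r.
  move=> [Uu uD] Ur Lr A LA; apply: filterS uD => m Dm.
  by apply: Lr; apply: IL.
have Lp r : UltraFilter r -> L `<=` r ->
    exists q, [/\ UltraFilter q, GD `<=` q & pmul q p = r].
  move=> Ur Lr; apply: pmul_closed => //; exact: subset_trans Lr.
have LD : L D.
  by apply: GL => s Ds; apply: filterS pD => t; apply: Dcat.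
have [e [Ue Le ee]] : exists e, [/\ UltraFilter e, L `<=` e & pmul e e = e].
  apply: ellis => // q r Uq Ur Lq Lr; apply: ucl => //; split=> //; exact: Lq.
have [e' [Ue' _ e'p]] := Lp e Ue Le.
have ep : pmul e p = e by rewrite -e'p -pmulA pp.
have onp : on D p by [].
have one : on D e by split=> //; apply: Le.
exists (pmul p e); split.
- exact: pmul_on.
- by rewrite -pmulA (pmulA e) ep ee.
- by rewrite pmulA pp.
- by rewrite -pmulA ep.
move=> u onu.
have onr : on D (pmul u (pmul p e)).
  exact: (pmul_on onu (pmul_on onp one)).
have Lr : L `<=` pmul u (pmul p e).
  exact: (ucl _ _ onu (pmul_ultra Up Ue) (ucl _ _ onp Ue Le)).
have [y [Uy Gy ye]] : exists y,
    [/\ UltraFilter y, GD `<=` y & pmul y (pmul u (pmul p e)) = e].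
  apply: pmul_closed => //; first by case: onr.
  (* The multiples of [u p e] form a closed left ideal inside the minimal one and so exhaust it; [e]
     is among them. *)
  suff -> : pmul GD (pmul u (pmul p e)) = L by [].
  apply: Lmax.
    by have [Ur _] := onr; split; [exact: pmul_filter|exact: GDideal].
  by move=> A LA m Dm; apply: Lr; apply: IL.
exists (pmul p y).
  by apply: pmul_on => //; split=> //; exact: Gy.
by rewrite -pmulA ye.
Qed.

End Minimal.

Lemma principal_on (D : set M) s : D s -> on D [set A | A s].
Proof.
move=> Ds; split=> //; apply: ultraP.
  by split=> //; split=> //; move=> A B AB; apply: AB.
by move=> A; have [?|?] := pselect (A s); [left|right].
Qed.

End UltrafilterSemigroup.

(** * Words and blocks *)

Definition words (K : nat) : set (seq nat) := [set w | all (ltn^~ K) w].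

Definition subst (K a : nat) : seq nat -> seq nat :=
  map (fun x => if x == K then a else x).

Lemma words_cat K s t : words K s -> words K t -> words K (s ++ t).
Proof. by rewrite /words /= all_cat => -> ->. Qed.

Lemma wordsS K w : words K w -> words K.+1 w.
Proof. by apply: sub_all => x /ltnW. Qed.

Lemma subst_cat K a s t : subst K a (s ++ t) = subst K a s ++ subst K a t.
Proof. exact: map_cat. Qed.

Lemma subst_words K a w : (a < K)%N -> words K.+1 w -> words K (subst K a w).
Proof.
move=> aK /allP ww; apply/allP => _ /mapP[x /ww xK ->].
by case: eqVneq => // xnK /=; rewrite ltn_neqAle xnK.
Qed.

Lemma subst_words_id K a w : words K w -> subst K a w = w.
Proof.
move=> /allP ww; rewrite -[RHS]map_id; apply/eq_in_map => x /ww.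
by case: eqVneq => // -> /=; rewrite ltnn.
Qed.

Lemma subst_id K w : subst K K w = w.
Proof. by rewrite -[RHS]map_id; apply: eq_map => x; case: eqVneq. Qed.

Lemma fmap_pmul (f : seq nat -> seq nat) p q :
  (forall s t, f (s ++ t) = f s ++ f t) ->
  fmap f (pmul p q) = pmul (fmap f p) (fmap f q).
Proof.
move=> f_cat; apply/funext => A; rewrite /fmap /pmul /=; congr (p _).
apply/funext => s /=; congr (q _); apply/funext => t.
by change (A (f (s ++ t)) = A (f s ++ f t)); rewrite f_cat.
Qed.

Lemma fmap_ultra (f : seq nat -> seq nat) p : UltraFilter p ->
  UltraFilter (fmap f p).
Proof.
by move=> Up; apply: ultraP => A; apply: (in_ultra_setVsetC (f @^-1` A) Up).
Qed.

Lemma fmap_subst K a p : UltraFilter p -> p (words K) -> fmap (subst K a) p = p.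
Proof.
move=> Up pK; apply/esym; apply: ultra_eq; first exact: fmap_ultra.
move=> A pA; rewrite /fmap /=; apply: filterS (filterI pA pK) => s [As Ks].
by rewrite /preimage /= subst_words_id.
Qed.

Lemma fmap_on K a p : (a < K)%N -> on (words K.+1) p ->
  on (words K) (fmap (subst K a) p).
Proof.
move=> aK [Up pK]; split; first exact: fmap_ultra.
by rewrite /fmap /=; apply: filterS pK => s; apply: subst_words.
Qed.

Lemma ultrafilter_chain K : exists p q y,
  [/\ on (words K) p, on (words K.+1) q & on (words K.+1) y] /\
  [/\ pmul p q = q, pmul q p = q, pmul q q = q,
    forall a, (a < K)%N -> fmap (subst K a) q = p &
    pmul q (pmul [set A | A [:: K]] y) = q].
Proof.
have w0 n : words n [::] by [].
(* The first idempotent to start from is the unit, the principal ultrafilter of the empty word; the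
   second is [p] itself. *)
have [p [onp pp _ _ pmin]] := min_idempotent (w0 K) (@words_cat K)
  (principal_on (w0 K)) (erefl _).
have onp' : on (words K.+1) p.
  case: onp => Up pK; split=> //; apply: filterS pK => s; exact: wordsS.
have [q [onq qq pq qp qmin]] := min_idempotent (w0 K.+1) (@words_cat K.+1)
  onp' pp.
have onK : on (words K.+1) [set A | A [:: K]].
  by apply: principal_on; rewrite /words /= ltnSn.
have onM := @pmul_on _ (words K.+1) (@words_cat K.+1).
(* Inverting q [K] q in the group q (beta M) q, whose unit is q. *)
have [y1 ony1 y1q] := qmin _ (onM _ _ onq onK).
have [y2 ony2 y2q] := qmin _ (onM _ _ onq ony1).
have inv : pmul (pmul q (pmul [set A | A [:: K]] q)) (pmul y1 q) = q.
  have e1 : pmul (pmul q (pmul y1 q)) (pmul q (pmul [set A | A [:: K]] q)) = q.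
    by rewrite -!pmulA (pmulA q q) qq; move: y1q; rewrite -!pmulA => ->.
  (* By [e1] and [e2], [q y1 q] is a left inverse of [g] and [y2] one of [q y1 q]. Hence [g = y2 q],
     and [q y1 q] is a right inverse of [g] too. *)
  set g := pmul q (pmul [set A | A [:: K]] q) in e1 *.
  have qg : pmul q g = g by rewrite /g pmulA qq.
  have e2 : pmul y2 (pmul q (pmul y1 q)) = q.
    by move: y2q; rewrite -!pmulA.
  have eg : g = pmul y2 q by rewrite -{1}qg -{1}e2 -pmulA e1.
  by rewrite eg -pmulA.
exists p, q, (pmul q (pmul y1 q)); split.
  by split=> //; do ?[apply: (onM) => //].
split=> //; last by rewrite -[RHS]inv -!pmulA.
(* The image [q'] is an idempotent below [p]. Minimality of [p] gives [z q' = p], so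
   [p q' = z q' q' = z q' = p], while [p q' = q']. *)
move=> a aK; set q' := fmap _ q.
have onq' : on (words K) q' by apply: fmap_on.
have pushM r s : fmap (subst K a) (pmul r s) =
    pmul (fmap (subst K a) r) (fmap (subst K a) s).
  exact/fmap_pmul/subst_cat.
have pushp : fmap (subst K a) p = p by case: onp => Up; apply: fmap_subst.
have pq' : pmul p q' = q' by rewrite -{1}pushp -pushM pq.
have q'p : pmul q' p = q' by rewrite -{1}pushp -pushM qp.
have q'q' : pmul q' q' = q' by rewrite -pushM qq.
have [z _ zq] := pmin _ onq'; rewrite q'p in zq.
by rewrite -{1}pq' -{1}zq -pmulA q'q' zq.
Qed.

(* [K] plays the role of the variable of the block v' ++ K :: v'', with the
   displayed occurrence marked; substituting a <= K for it gives [block]. *)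
Definition block (K a : nat) (v : seq nat * seq nat) : seq nat :=
  subst K a (v.1 ++ K :: v.2).

Definition inst (K : nat) (v : nat -> seq nat * seq nat) (z : seq nat) :=
  flatten [seq block K (nth 0%N z i) (v i) | i <- iota 0 (size z)].

Lemma inst_rcons K v z a :
  inst K v (rcons z a) = inst K v z ++ block K a (v (size z)).
Proof.
rewrite /inst size_rcons -addn1 iotaD map_cat flatten_cat /= cats0 add0n.
rewrite nth_rcons ltnn eqxx; congr (flatten _ ++ _).
by apply/eq_in_map => i; rewrite mem_iota add0n /= => iz; rewrite nth_rcons iz.
Qed.

Lemma ultra_color (T : Type) (I : finType) (p : set_system T) (f : T -> I) :
  UltraFilter p -> exists a, p [set x | f x = a].
Proof.
move=> Up; apply: contrapT => nex.
suff /filter_ex[x /(_ (f x))] : p [set x | forall a, f x <> a] by [].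
suff H (s : seq I) : p [set x | f x \notin s].
  apply: filterS (H (enum I)) => x /=; by rewrite mem_enum.
elim: s => [|a s IHs]; first by apply: filterS filterT.
have [pa|pa] := in_ultra_setVsetC [set x | f x = a] Up.
  by case: nex; exists a.
apply: filterS (filterI pa IHs) => x /= [/eqP fa fs].
by rewrite inE negb_or fa.
Qed.

Lemma filter_all (T : Type) (I : eqType) (p : set_system T) (s : seq I)
    (A : I -> set T) : ProperFilter p -> (forall i, i \in s -> p (A i)) ->
  p [set x | forall i, i \in s -> A i x].
Proof.
move=> Pp; elim: s => [|i s IHs] pA; first by apply: filterS filterT.
have pi := pA i (mem_head _ _).
have /IHs ps : forall j, j \in s -> p (A j).
  by move=> j js; apply: pA; rewrite inE js orbT.
apply: filterS (filterI pi ps) => x [Ax Asx] j.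
by rewrite inE => /orP[/eqP -> //|]; apply: Asx.
Qed.

Lemma block_coloring (K l : nat) (chi : seq nat -> 'I_l) :
  exists (v : nat -> seq nat * seq nat) (a : 'I_l),
    (forall m, words K.+1 (v m).1 /\ words K.+1 (v m).2) /\
    forall z, words K.+1 z -> chi (inst K v z ++ (v (size z)).1) = a.
Proof.
have [p [q [y [[[Up pK] [Uq qK] [Uy yK]] [pq qp qq pushq qy]]]]] :=
  ultrafilter_chain K.
have [a qa] := ultra_color chi Uq.
set A := [set z | chi z = a] in qa.
(* The words that [q]-most continuations bring to colour [a]. As [p q = q = q q], both [p]-most and
   [q]-most continuations stay in [C]. *)
pose C := [set u | q (lquot u A)].
have Cp u : C u -> p (lquot u C).
  rewrite /C /= -{1}pq; apply: (@filterS _ p) => s /=.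
  by rewrite -lquot_cat.
have Cq u : C u -> q (lquot u C).
  rewrite /C /= -{1}qq; apply: (@filterS _ q) => s /=.
  by rewrite -lquot_cat.
pose good (P : seq (seq nat)) (v : seq nat * seq nat) :=
  (words K.+1 v.1 /\ words K.+1 v.2) /\
  forall u, u \in P -> A (u ++ v.1) /\
    forall b, (b <= K)%N -> C (u ++ block K b v).
have step (P : seq (seq nat)) : exists v, (forall u, u \in P -> C u) -> good P v.
  have [CP|nCP] := pselect (forall u, u \in P -> C u); last by exists ([::], [::]).
  pose Z u b : set (seq nat) := [set z | C (u ++ subst K b z)].
  (* Substituting [b < K] turns [q] into [p], and [b = K] leaves [q] unchanged. *)
  have qZ u b : u \in P -> (b <= K)%N -> q (Z u b).
    move=> uP; rewrite leq_eqVlt => /orP[/eqP->|bK].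
      by apply: filterS (Cq _ (CP _ uP)) => z; rewrite /Z /= subst_id.
    by have := Cp _ (CP _ uP); rewrite -(pushq _ bK).
  have qZ' : q [set z | forall u, u \in P -> forall b, b \in iota 0 K.+1 -> Z u b z].
    apply: filter_all => u uP; apply: filter_all => b.
    by rewrite mem_iota => /andP[_ bK]; apply: qZ.
  set Z' := [set z | _] in qZ'.
  have qA : q [set v' | forall u, u \in P -> A (u ++ v')].
    by apply: filter_all => u /CP.
  (* As [q = q [K] y], for [q]-most [v'] there is [v''] with [v' ++ K :: v''] in [Z']; such a [v']
     can also be taken to complete every word of [P] to colour [a]. *)
  move: qZ'; rewrite -{1}qy /pmul /= => qZ'.
  have [v' [[Av' yv'] wv']] : exists v', ((forall u, u \in P -> A (u ++ v')) /\
      y (lquot [:: K] (lquot v' Z'))) /\ words K.+1 v'.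
    apply: (@filter_ex _ q); apply: filterI qK; exact: filterI qA qZ'.
  have [v'' [Zv'' wv'']] : exists v'', lquot [:: K] (lquot v' Z') v'' /\
      words K.+1 v''.
    by apply: (@filter_ex _ y); apply: filterI yv' yK.
  exists (v', v'') => _; split=> // u uP; split; first exact: Av'.
  move=> b bK; have := Zv'' u uP b; rewrite mem_iota /= ltnS bK; exact.
have [f fP] := choice step.
(* [Ps m] lists the finitely many instances of the first [m] blocks, [b = K] keeping the variable;
   the next block is chosen for all of them at once. *)
pose ext P v := [seq u ++ block K b v | u <- P, b <- iota 0 K.+1].
pose Ps := fix Ps m := if m is m'.+1 then ext (Ps m') (f (Ps m')) else [:: [::]].
have CPs m u : u \in Ps m -> C u.
  elim: m u => [|m IHm] u /=.
    by rewrite inE => /eqP ->; apply: filterS qa.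
  move=> /allpairsP[[u' b] /= [uP]]; rewrite -/(iota 0 K.+1) mem_iota => /andP[_ bK] ->.
  by have [_ /(_ _ uP)[_]] := fP _ IHm; apply.
exists (f \o Ps), a; split; first by move=> m; have [] := fP _ (CPs m).
have instP z : words K.+1 z -> inst K (f \o Ps) z \in Ps (size z).
  elim/last_ind: z => [|z b IHz] //.
  rewrite /words /= all_rcons => /andP[bK wz].
  rewrite inst_rcons size_rcons /=; apply/allpairsP.
  exists (inst K (f \o Ps) z, b) => /=; split=> //; first exact: IHz.
  by rewrite -/(iota 0 K.+1) mem_iota.
move=> z wz; have [_ /(_ _ (instP z wz))[]] := fP _ (CPs (size z)).
by [].
Qed.

(** * Fusion *)

Section Rigid.
Context {dL dK : Order.disp_t} {L : orderType dL} {K : orderType dK}.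

Lemma rigid_ext (f h : rigid L K) :
  rsurj f =1 rsurj h -> rsect f =1 rsect h -> f = h.
Proof.
case: f h => [r c ch rK rle] [r' c' ch' rK' rle'] /= /funext rr' /funext cc'.
subst r' c'.
by congr Rigid; apply: Prop_irrelevance.
Qed.

Variables (r : L -> K) (c : K -> L).
Hypothesis rK : forall x, r (c x) = x.
Hypothesis rle : forall x y, (y <= c x)%O -> (r y <= x)%O.

Lemma mk_rigid_homo : {homo c : x y / (x < y)%O}.
Proof.
move=> x y xy; case: Order.TotalTheory.leP => // /rle.
by rewrite rK Order.TotalTheory.leNgt xy.
Qed.

Definition mk_rigid : rigid L K := Rigid mk_rigid_homo rK rle.

End Rigid.

Lemma rcompA {d1 d2 d3 d4 : Order.disp_t} {T1 : orderType d1} {T2 : orderType d2}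
    {T3 : orderType d3} {T4 : orderType d4}
    (f : rigid T3 T4) (h : rigid T2 T3) (k : rigid T1 T2) :
  rcomp f (rcomp h k) = rcomp (rcomp f h) k.
Proof. exact: rigid_ext. Qed.

Lemma id_rigid_le (x y : nat) : (y <= id x)%O -> (id y <= x)%O.
Proof. by []. Qed.

Definition id_rigid : rigid nat nat :=
  mk_rigid (fun x => erefl (id x)) id_rigid_le.

Lemma id_rcomp (h : rigid nat nat) : rcomp id_rigid h = h.
Proof. exact: rigid_ext. Qed.

Lemma rsurj_leq (h : rigid nat nat) x y : y <= rsect h x -> rsurj h y <= x.
Proof. exact: (@rsurj_le _ _ _ _ h x y). Qed.

Lemma rsect_ltn (h : rigid nat nat) x y : x < y -> rsect h x < rsect h y.
Proof. exact: (@rsect_homo _ _ _ _ h x y). Qed.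

Lemma leq_rsect (h : rigid nat nat) x : x <= rsect h x.
Proof. by elim: x => // x IHx; apply: leq_ltn_trans IHx _; apply: rsect_ltn. Qed.

Lemma rsurj_leq_id (h : rigid nat nat) x : rsurj h x <= x.
Proof. exact/rsurj_leq/leq_rsect. Qed.

Definition fixes (n : nat) (e : rigid nat nat) :=
  forall i, i < n -> rsurj e i = i /\ rsect e i = i.

Lemma fixes_id n : fixes n id_rigid. Proof. by []. Qed.

Lemma fixesW m n e : n <= m -> fixes m e -> fixes n e.
Proof. by move=> nm fe i /leq_trans/(_ nm)/fe. Qed.

Lemma fixes_comp n e e' : fixes n e -> fixes n e' -> fixes n (rcomp e e').
Proof.
move=> fe fe' i ni; have [re ce] := fe i ni; have [re' ce'] := fe' i ni.
by rewrite /= re' ce re ce'.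
Qed.

Fixpoint compose (e : nat -> rigid nat nat) (m : nat) : rigid nat nat :=
  if m is m'.+1 then rcomp (e m') (compose e m') else id_rigid.

(** The factors from [i.+1] on fix [i] and everything below it, and [rsurj] never increases its
    argument. *)
Lemma compose_stable e : (forall m, fixes m (e m)) -> forall i m, i < m ->
  rsurj (compose e m) i = rsurj (compose e i.+1) i /\
  rsect (compose e m) i = rsect (compose e i.+1) i.
Proof.
move=> fe i; elim=> // m IHm; rewrite ltnS leq_eqVlt => /orP[/eqP <-//|im].
have [ri ci] := IHm im; rewrite -ri -ci /=; split.
  have rm : rsurj (compose e m) i < m by apply: leq_ltn_trans im; apply: rsurj_leq_id.
  by have [] := fe m _ rm.
by have [_ ->] := fe m _ im.
Qed.

Lemma compose_limit e : (forall m, fixes m (e m)) ->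
  exists h, forall m i, i < m ->
    rsurj h i = rsurj (compose e m) i /\ rsect h i = rsect (compose e m) i.
Proof.
move=> /compose_stable st.
pose r i := rsurj (compose e i.+1) i; pose c i := rsect (compose e i.+1) i.
have rE i m : i < m -> r i = rsurj (compose e m) i by move=> /st[].
have cE i m : i < m -> c i = rsect (compose e m) i by move=> /st[].
have rK x : r (c x) = x.
  have [m cm xm] : exists2 m, c x < m & x < m.
    by exists (maxn (c x) x).+1; rewrite ltnS ?leq_maxl ?leq_maxr.
  by rewrite (rE _ m) // (cE _ m) // rsectK.
have rle (x y : nat) : (y <= c x)%O -> (r y <= x)%O.
  rewrite (rE _ (maxn x y).+1) ?ltnS ?leq_maxr //.
  rewrite (cE _ (maxn x y).+1) ?ltnS ?leq_maxl //.
  exact: rsurj_le.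
by exists (mk_rigid rK rle) => m i im; split; [apply: rE|apply: cE].
Qed.

(** [Q n] is achieved at stage [n]. The limit is this stage followed by an element fixing [n], since
    all later factors do, and so keeps [Q n]. *)
Lemma fusion (Q : nat -> rigid nat nat -> Prop) :
  (forall n h, exists2 e, fixes n e & Q n (rcomp e h)) ->
  (forall n h e, Q n h -> fixes n e -> Q n (rcomp e h)) ->
  exists h, forall n, Q n h.
Proof.
move=> Qex Qst.
have /choice[E EP] : forall nh : nat * rigid nat nat,
    exists e, fixes nh.1 e /\ Q nh.1 (rcomp e nh.2).
  by move=> [n h]; have [e fe Qe] := Qex n h; exists e.
pose hs := fix hs m := if m is m'.+1 then rcomp (E (m', hs m')) (hs m')
  else id_rigid.
pose e m := E (m, hs m).
have fe m : fixes m (e m) by have [] := EP (m, hs m).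
have hsE m : hs m = compose e m by elim: m => //= m <-.
have [h hP] := compose_limit fe.
(* Replacing the factors [0] to [n] by the identity isolates the part [g] of the limit that comes
   after stage [n]. *)
exists h => n; pose e' m := if m <= n then id_rigid else e m.
have fe' m : fixes m (e' m) by rewrite /e'; case: leqP.
have compE m : n < m -> compose e m = rcomp (compose e' m) (compose e n.+1).
  elim: m => // m IHm; rewrite ltnS leq_eqVlt => /orP[/eqP <-|nm].
    rewrite (_ : compose e' n.+1 = id_rigid) ?id_rcomp //.
    elim: {-2}n (leqnn n) => [|k IHk] kn.
      by rewrite /= /e' leq0n id_rcomp.
    by have := IHk (ltnW kn); rewrite /= => ->; rewrite /e' kn id_rcomp.
  by rewrite /= IHm // rcompA /e' leqNgt nm.
have fc m : fixes n (compose e' m).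
  elim: m => [|m IHm]; [exact: fixes_id|apply: fixes_comp => //].
  rewrite /e'; case: leqP => nm; first exact: fixes_id.
  exact: fixesW (ltnW nm) (fe m).
have [g gP] := compose_limit fe'.
have fg : fixes n g.
  by move=> i ni; have [-> ->] := gP n i ni; apply: fc.
suff -> : h = rcomp g (compose e n.+1).
  by apply: Qst => //; rewrite -hsE; have [] := EP (n, hs n).
apply: rigid_ext => i.
  have im : i < (maxn n i).+1 by rewrite ltnS leq_maxr.
  have [-> _] := hP _ _ im; rewrite compE ?ltnS ?leq_maxl //=.
  have lt := leq_ltn_trans (rsurj_leq_id (compose e n.+1) i) im.
  by have [->] := gP _ _ lt.
have im : i < (maxn n i).+1 by rewrite ltnS leq_maxr.
have [_ ->] := hP _ _ im; rewrite compE ?ltnS ?leq_maxl //=.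
by have [_ ->] := gP _ _ im.
Qed.

(** * Stems *)

(* A K-stem is an element (w, j) of F_{n,K}, as the lists of values of r and
   of c, whose last mark j_(K-1) is its last position n - 1. *)
Fixpoint stem (K : nat) (w j : seq nat) : Prop :=
  if K is K'.+1 then exists w0 z j0,
    [/\ stem K' w0 j0, words K z, w = w0 ++ rcons z K' &
        j = rcons j0 (size w0 + size z)]
  else w = [::] /\ j = [::].

Lemma stem_words K w j : stem K w j -> words K w.
Proof.
elim: K w j => [|K IHK] w j /=; first by case=> ->.
case=> w0 [z [j0 [/IHK/wordsS w0K zK -> _]]].
apply: words_cat => //; rewrite /words /= all_rcons ltnSn; exact: zK.
Qed.

Lemma stem_size K w j : stem K w j -> size j = K.
Proof.
elim: K w j => [|K IHK] w j /=; first by case=> _ ->.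
by case=> w0 [z [j0 [/IHK <- _ _ ->]]]; rewrite size_rcons.
Qed.

Lemma stem_marks K w j : stem K w j -> forall x, x < K ->
  [/\ nth 0 j x < size w, nth 0 w (nth 0 j x) = x &
      forall y, y <= nth 0 j x -> nth 0 w y <= x].
Proof.
elim: K w j => [|K IHK] w j //= [w0 [z [j0 [st0 zK -> ->]]]] x.
have stw : stem K.+1 (w0 ++ rcons z K) (rcons j0 (size w0 + size z)).
  by exists w0, z, j0.
rewrite ltnS leq_eqVlt nth_rcons (stem_size st0) => /orP[/eqP ->|xK].
  rewrite ltnn eqxx size_cat size_rcons addnS ltnSn.
  rewrite nth_cat ltnNge leq_addr /= addKn nth_rcons ltnn eqxx; split=> // y yz.
  have /allP wK := stem_words stw; apply: (wK (nth 0 _ y)).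
  apply: mem_nth.
  by rewrite size_cat size_rcons addnS ltnS.
rewrite xK; have [jx wjx wle] := IHK _ _ st0 _ xK; split.
- by rewrite size_cat (leq_trans jx) // leq_addr.
- by rewrite nth_cat jx.
- by move=> y yj; rewrite nth_cat (leq_ltn_trans yj jx); apply: wle.
Qed.

(** The length of [h] cut just after its mark of [n - 1]. *)
Definition len (h : rigid nat nat) (n : nat) : nat :=
  if n is n'.+1 then (rsect h n').+1 else 0.

(** The counterpart of [rcomp] for stems: the composition with [h], cut at its last mark. *)
Definition act (h : rigid nat nat) (s : seq nat * seq nat) :=
  (mkseq (fun i => nth 0 s.1 (rsurj h i)) (len h (size s.1)),
   map (rsect h) s.2).

Lemma len_rsurj h n i : i < len h n -> rsurj h i < n.
Proof. by case: n => //= n; rewrite !ltnS; apply: rsurj_leq. Qed.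

Lemma act_comp e h s : act (rcomp e h) s = act h (act e s).
Proof.
rewrite /act /= -map_comp; congr pair.
have -> : len (rcomp e h) (size s.1) =
    len h (size (mkseq (fun i => nth 0 s.1 (rsurj e i)) (len e (size s.1)))).
  by rewrite size_mkseq; case: (size s.1).
rewrite size_mkseq; apply/eq_in_map => i; rewrite mem_iota /= add0n => il.
by rewrite nth_mkseq // len_rsurj.
Qed.

Lemma mkseqD (T : Type) (f : nat -> T) m d :
  mkseq f (m + d.+1) =
  mkseq f m ++ rcons (mkseq (fun i => f (m + i)) d) (f (m + d)).
Proof.
rewrite addnS mkseqS /mkseq iotaD map_cat add0n rcons_cat.
by rewrite -[X in iota X d]addn0 iotaDl -map_comp.
Qed.

Lemma len_leq h m n : m <= n -> len h m <= rsect h n.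
Proof. by case: m => //= m; apply: rsect_ltn. Qed.

(** The letters of the composed stem between the image of [w0] and the last mark. *)
Definition act_mid h (w0 w : seq nat) m : seq nat :=
  mkseq (fun i => nth 0 w (rsurj h (len h (size w0) + i)))
        (rsect h m - len h (size w0)).

Lemma act_extend h w0 z a j0 (w := w0 ++ rcons z a) (m := size w0 + size z) :
  let s := act h (w0, j0) in let z' := act_mid h w0 w m in
  act h (w, rcons j0 m) =
    (s.1 ++ rcons z' a, rcons s.2 (size s.1 + size z')).
Proof.
have w_size : size w = m.+1 by rewrite size_cat size_rcons addnS.
have lm : len h (size w0) <= rsect h m by apply/len_leq/leq_addr.
rewrite /act /= map_rcons !size_mkseq subnKC //; congr pair.
rewrite w_size /= -{1}(subnKC lm) -addnS mkseqD subnKC //.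
congr (_ ++ rcons _ _).
  apply/eq_in_map => i; rewrite mem_iota add0n /= => /len_rsurj il.
  by rewrite nth_cat il.
by rewrite rsectK nth_cat ltnNge leq_addr /= addKn nth_rcons ltnn eqxx.
Qed.

Lemma act_mid_words h w0 w m K : words K w -> m < size w ->
  words K (act_mid h w0 w m).
Proof.
move=> /allP wK mw; apply/allP => _ /mapP[i + ->]; rewrite mem_iota add0n => im.
apply/wK/mem_nth; apply: leq_ltn_trans mw; apply: rsurj_leq.
by apply: ltnW; rewrite -ltn_subRL.
Qed.

Lemma stem_act h K w j : stem K w j -> stem K (act h (w, j)).1 (act h (w, j)).2.
Proof.
elim: K w j => [|K IHK] w j; first by case=> -> ->.
move=> [w0 [z [j0 [st0 zK wE jE]]]].
have stw : stem K.+1 w j by exists w0, z, j0.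
exists (act h (w0, j0)).1, (act_mid h w0 w (size w0 + size z)), (act h (w0, j0)).2.
have actE := act_extend h w0 z K j0; rewrite /= -wE -jE in actE.
rewrite actE; split=> //; first exact: IHK.
apply: act_mid_words; first exact: stem_words stw.
by rewrite wE size_cat size_rcons addnS.
Qed.

Lemma fixes_len n e m : fixes n e -> m <= n -> len e m = m.
Proof. by case: m => // m fe mn /=; have [_ ->] := fe m mn. Qed.

Lemma act_fixes n e K w j : fixes n e -> stem K w j -> size w = n ->
  act e (w, j) = (w, j).
Proof.
move=> fe st wn; rewrite /act /= wn (fixes_len fe) //; congr pair.
  apply: (@eq_from_nth _ 0); rewrite size_mkseq // => i iN.
  by rewrite nth_mkseq //; have [-> _] := fe i iN.
rewrite -[RHS]map_id; apply/eq_in_map => x /(nthP 0)[i ij <-].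
move: ij; rewrite (stem_size st) => /(stem_marks st)[+ _ _]; rewrite wn.
by move=> /fe[].
Qed.

(* The element of F_{omega,omega} extending the identity of n = size w whose
   m-th further block is v m, where the letter K stands for the new variable
   n + m, marked between (v m).1 and (v m).2, and a letter x < K is represented
   by the variable j_x, which the stem (w, j) sends to x. *)
Section Build.
Variables (K : nat) (w j : seq nat) (v : nat -> seq nat * seq nat).
Hypothesis st : stem K w j.
Hypothesis wv : forall m, words K.+1 (v m).1 /\ words K.+1 (v m).2.
Local Notation n := (size w).

Definition enc m : seq nat -> seq nat :=
  map (fun x => if x == K then n + m else nth 0 j x).
Definition new_block m := enc m ((v m).1 ++ K :: (v m).2).
Definition prefix m := flatten [seq new_block i | i <- iota 0 m].

Lemma prefixS m : prefix m.+1 = prefix m ++ new_block m.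
Proof.
by rewrite /prefix -addn1 iotaD map_cat flatten_cat /= cats0 add0n.
Qed.

Lemma leq_size_prefix m : m <= size (prefix m).
Proof.
elim: m => // m IHm; rewrite prefixS size_cat size_map size_cat /= addnS.
by rewrite addnS ltnS (leq_trans IHm) // leq_addr.
Qed.

Lemma nth_prefix m m' i : m <= m' -> i < size (prefix m) ->
  nth 0 (prefix m') i = nth 0 (prefix m) i.
Proof.
move=> mm' im; rewrite -(subnKC mm') /prefix iotaD map_cat flatten_cat.
by rewrite -/(prefix m) nth_cat im.
Qed.

Lemma prefix_bound m x : x \in prefix m -> x < n + m.
Proof.
elim: m => // m IHm; rewrite prefixS mem_cat => /orP[/IHm|].
  by rewrite addnS ltnS; apply: ltnW.
move=> /mapP[y yv ->]; case: ifP => yK; first by rewrite addnS.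
have [jy _ _] : [/\ nth 0 j y < n, nth 0 w (nth 0 j y) = y &
    forall z, z <= nth 0 j y -> nth 0 w z <= y].
  apply: (stem_marks st); have [/allP w1 /allP w2] := wv m.
  have yK' : y < K.+1.
    move: yv; rewrite mem_cat inE yK /= => /orP[/w1|/w2] //.
  by rewrite ltn_neqAle yK.
by rewrite (leq_trans jy) // leq_addr.
Qed.

(** Blocks are nonempty, so the first [y - n + 1] of them reach position [y - n]. *)
Definition build_surj y :=
  if y < n then y else nth 0 (prefix (y - n).+1) (y - n).
Definition build_mark m := size (prefix m) + size (v m).1.
Definition build_sect x := if x < n then x else n + build_mark (x - n).

Lemma build_surjE m i : i < size (prefix m) ->
  build_surj (n + i) = nth 0 (prefix m) i.
Proof.
move=> im; rewrite /build_surj ltnNge leq_addr /= addKn.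
have [mi|im'] := leqP m i.+1; first exact: nth_prefix.
by apply/esym/nth_prefix; [exact: ltnW|exact: leq_size_prefix].
Qed.

Lemma build_mark_lt m : build_mark m < size (prefix m.+1).
Proof.
by rewrite prefixS size_cat size_map size_cat /= /build_mark ltn_add2l addnS
  ltnS leq_addr.
Qed.

Lemma build_surjK x : build_surj (build_sect x) = x.
Proof.
rewrite /build_sect; case: ltnP => xn; first by rewrite /build_surj xn.
rewrite (build_surjE (build_mark_lt _)) prefixS nth_cat ltnNge leq_addr /=.
rewrite addKn (nth_map 0); last by rewrite size_cat /= addnS ltnS leq_addr.
by rewrite nth_cat ltnn subnn eqxx subnKC.
Qed.

Lemma build_surj_le x y : (y <= build_sect x)%O -> (build_surj y <= x)%O.
Proof.
suff H : y <= build_sect x -> build_surj y <= x by [].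
have [yn|ny] := ltnP y n.
  rewrite /build_surj yn /build_sect; case: ltnP => // nx _.
  exact: leq_trans (ltnW yn) nx.
rewrite /build_sect; case: ltnP => [xn yx|nx].
  by move: (leq_ltn_trans yx xn); rewrite ltnNge ny.
rewrite -{1}(subnKC ny) leq_add2l => yx.
have lt := leq_ltn_trans yx (build_mark_lt _).
rewrite -(subnKC ny) (build_surjE lt).
have := prefix_bound (mem_nth 0 lt).
by rewrite addnS ltnS subnKC.
Qed.

Definition build : rigid nat nat := mk_rigid build_surjK build_surj_le.

Lemma fixes_build : fixes n build.
Proof. by move=> i ni /=; rewrite /build_surj /build_sect ni. Qed.

(** [dec] reads variables back as letters. Block [m] is cut at its mark, so its own variable [n + m]
    must either be absent or be read as [K]. *)
Lemma build_decode (dec : nat -> nat) z m :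
  (forall x, x < K -> dec (nth 0 j x) = x) ->
  (forall i, i < m -> dec (n + i) = nth 0 z i) -> size z = m ->
  (words K (v m).1 \/ dec (n + m) = K) ->
  mkseq (fun i => dec (build_surj (n + i))) (build_mark m) =
  inst K v z ++ (v m).1.
Proof.
move=> decj decz zm decK.
have decE i y : i < m -> y < K.+1 ->
    dec (if y == K then n + i else nth 0 j y) = if y == K then nth 0 z i else y.
  by move=> im yK; case: eqVneq => yK'; [apply: decz|apply: decj; lia].
have -> : mkseq (fun i => dec (build_surj (n + i))) (build_mark m) =
    map dec (prefix m ++ enc m (v m).1).
  apply: (@eq_from_nth _ 0).
    by rewrite size_mkseq size_map size_cat size_map.
  move=> i; rewrite size_mkseq => im; rewrite nth_mkseq //.
  rewrite (nth_map 0) ?size_cat ?size_map //.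
  rewrite (build_surjE (ltn_trans im (build_mark_lt _))) prefixS.
  rewrite /new_block /enc map_cat catA [in LHS]nth_cat.
  by rewrite size_cat size_map im.
rewrite map_cat; congr (_ ++ _).
  rewrite /prefix /inst map_flatten zm -map_comp; congr flatten.
  apply/eq_in_map => i; rewrite mem_iota add0n => /= im.
  rewrite /new_block /enc /block /subst -map_comp; apply/eq_in_map => y yv /=.
  rewrite decE //; have [/allP w1 /allP w2] := wv i.
  by move: yv; rewrite mem_cat inE => /or3P[/w1|/eqP ->|/w2].
rewrite -map_comp -[RHS]map_id; apply/eq_in_map => y yv /=.
have [/allP/(_ y yv)/= yK _] := wv m.
case: eqVneq => [yE|yK']; last by apply: decj; lia.
by case: decK => [/allP/(_ y yv)|->//]; rewrite yE /= ltnn.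
Qed.

Lemma act_build z : words K.+1 z ->
  act build (w ++ rcons z K, rcons j (n + size z)) =
  (w ++ rcons (inst K v z ++ (v (size z)).1) K,
   rcons j (n + size (inst K v z ++ (v (size z)).1))).
Proof.
move=> wz; have := act_extend build w z K j.
rewrite (act_fixes fixes_build st erefl) /= => ->.
suff -> : act_mid build w (w ++ rcons z K) (n + size z) =
  inst K v z ++ (v (size z)).1 by [].
rewrite -(@build_decode (nth 0 (w ++ rcons z K))) //.
- rewrite /act_mid (fixes_len fixes_build) // /= /build_sect ltnNge leq_addr /=.
  by rewrite !addKn.
- by move=> x xK; have [jx wjx _] := stem_marks st xK; rewrite nth_cat jx.
- move=> i im; rewrite nth_cat ltnNge leq_addr /= addKn nth_rcons im //.
- by right; rewrite nth_cat ltnNge leq_addr /= addKn nth_rcons ltnn eqxx.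
Qed.

End Build.

(** * A Ramsey theorem for stems *)

Section StemColoring.
Variables (K l : nat) (gam : seq nat * seq nat -> 'I_l).

Definition good_stem (h : rigid nat nat) (w j : seq nat) :=
  exists a, forall z, words K.+1 z ->
    gam (act h (w ++ rcons z K, rcons j (size w + size z))) = a.

Lemma good_stem_fixes h e w j : good_stem h w j -> fixes (size w) e ->
  stem K w j -> good_stem (rcomp e h) w j.
Proof.
move=> [a ha] fe st; exists a => z wz; rewrite act_comp act_extend.
rewrite (act_fixes fe st erefl) ha //.
apply: (@act_mid_words _ _ _ _ K.+1); last by rewrite size_cat size_rcons addnS.
apply: words_cat; first exact/wordsS/(stem_words st).
by rewrite /words /= all_rcons ltnSn.
Qed.

(** By [act_build], composing with [build] turns the last part [z] into a word of the form on which
    [block_coloring] makes the colour constant. *)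
Lemma good_stem_exists h w j : stem K w j ->
  exists2 e, fixes (size w) e & good_stem (rcomp e h) w j.
Proof.
move=> st; have [v [a [wv va]]] := block_coloring K
  (fun z => gam (act h (w ++ rcons z K, rcons j (size w + size z)))).
exists (build st wv); first exact: fixes_build.
by exists a => z wz; rewrite act_comp act_build // va.
Qed.

End StemColoring.

Section StemFusion.
Variables (K : nat) (R : rigid nat nat -> seq nat -> seq nat -> Prop).
Hypothesis R_fixes : forall h e w j, R h w j -> fixes (size w) e ->
  stem K w j -> R (rcomp e h) w j.
Hypothesis R_exists : forall h w j, stem K w j ->
  exists2 e, fixes (size w) e & R (rcomp e h) w j.

Lemma stem_finite n : exists s : seq (seq nat * seq nat),
  forall w j, stem K w j -> size w = n -> (w, j) \in s.
Proof.
exists [seq (map val (val t.1), map val (val t.2)) |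
  t <- enum {: n.-tuple 'I_K * K.-tuple 'I_n}] => w j st wn.
have toOrd m (s : seq nat) : all (ltn^~ m) s ->
    exists s' : seq 'I_m, map val s' = s.
  elim: s => [|x s IHs]; first by exists [::].
  by move=> /= /andP[xm /IHs[s' <-]]; exists (Ordinal xm :: s').
have [w' w'E] := toOrd K w (stem_words st).
have [j' j'E] : exists s' : seq 'I_n, map val s' = j.
  apply: toOrd; apply/allP => x /(nthP 0)[i ij <-].
  by move: ij; rewrite (stem_size st) => /(stem_marks st)[]; rewrite wn.
have sw : size w' == n by rewrite -wn -w'E size_map.
have sj : size j' == K by rewrite -(stem_size st) -j'E size_map.
apply/mapP; exists (Tuple sw, Tuple sj); first by rewrite mem_enum.
by rewrite /= w'E j'E.
Qed.

(** At stage [n] the finitely many stems of size [n] are treated in turn; those already treated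
    survive, as later factors fix [n]. *)
Lemma stem_fusion : exists h, forall w j, stem K w j -> R h w j.
Proof.
have [|n h e hR fe w j st wn|h hP] :=
  @fusion (fun n h => forall w j, stem K w j -> size w = n -> R h w j).
- move=> n h; have [s sP] := stem_finite n.
  suff [e fe eP] : exists2 e, fixes n e & forall w j, (w, j) \in s ->
      stem K w j -> size w = n -> R (rcomp e h) w j.
    by exists e => // w j st wn; apply: eP => //; apply: sP.
  elim: s {sP} => [|[w j] s [e fe eP]].
    by exists id_rigid => //; apply: fixes_id.
  have [[st wn]|nst] := pselect (stem K w j /\ size w = n); last first.
    exists e => // w' j'; rewrite inE => /orP[/eqP[-> ->]|]; last exact: eP.
    by move=> st wn; case: nst.
  have [e' fe' e'P] := R_exists (rcomp e h) st; rewrite wn in fe'.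
  exists (rcomp e' e); first exact: fixes_comp.
  move=> w' j'; rewrite -rcompA inE => /orP[/eqP[-> ->] //|w's st' wn'].
  by apply: R_fixes => //; [exact: eP|rewrite wn'].
- by apply: R_fixes => //; [exact: hR|rewrite wn].
- by exists h => w j st; apply: hP st erefl.
Qed.

End StemFusion.

Lemma stem_ramsey (K l : nat) (gam : seq nat * seq nat -> 'I_l) :
  exists h a, forall w j, stem K w j -> gam (act h (w, j)) = a.
Proof.
elim: K gam => [|K IHK] gam.
  by exists id_rigid, (gam ([::], [::])) => w j [-> ->].
have [h hP] := stem_fusion (@good_stem_fixes K l gam) (@good_stem_exists K l gam).
(* Once the last part of a stem is irrelevant to its colour, the empty one represents all, leaving a
   colouring of [K]-stems. *)
pose gam' s := gam (act h (s.1 ++ rcons [::] K, rcons s.2 (size s.1 + 0))).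
have [h' [a aP]] := IHK gam'.
exists (rcomp h' h), a => w j st; rewrite act_comp.
have [w0 [z [j0 [st0 zK wE jE]]]] := st.
have [b bP] := hP _ _ (stem_act h' st0).
rewrite wE jE act_extend bP; last first.
  apply: act_mid_words; rewrite -wE; first exact: stem_words st.
  by rewrite wE size_cat size_rcons addnS.
by rewrite -(aP _ _ st0) /gam' bP.
Qed.

(** * The property of Baire *)

Section Baire.
Variable K : nat.
Local Notation X := (nat -> 'I_K).
Implicit Types (A B M N : set X) (x y : X) (w : seq nat).

Definition cyl w : set X := [set y | forall i, i < size w -> y i = nth 0 w i :> nat].

Definition agree n x y := forall i, i < n -> y i = x i.

Definition nowhere_dense N := forall w, words K w ->
  exists2 w', words K w' & forall y, cyl (w ++ w') y -> ~ N y.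

Definition meager M := exists2 N : nat -> set X,
  (forall i, nowhere_dense (N i)) & M `<=` \bigcup_i N i.

(* Equivalent to the property of Baire: A is relatively clopen in the
   complement of a meager set. *)
Definition baire_prop A := exists2 M, meager M &
  forall x, ~ M x -> exists n, forall y, ~ M y -> agree n x y -> (A y <-> A x).

Lemma nowhere_dense0 : nowhere_dense set0.
Proof. by move=> w _; exists [::] => // y _ []. Qed.

Lemma meager_bigcup (I : countType) (M : I -> set X) :
  (forall i, meager (M i)) -> meager (\bigcup_i M i).
Proof.
move=> mM; have /choice[N NP] : forall i, exists N : nat -> set X,
    (forall k, nowhere_dense (N k)) /\ M i `<=` \bigcup_k N k.
  by move=> i; have [N] := mM i; exists N.
exists (fun m => if @unpickle (nat * I)%type m is Some (k, i) then N i k else set0).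
  move=> m; case: unpickle => [[k i]|]; last exact: nowhere_dense0.
  exact: (NP i).1.
move=> x [i _ /(NP i).2[k _ Nx]].
by exists (pickle (k, i)) => //; rewrite pickleK.
Qed.

Lemma meagerS A B : A `<=` B -> meager B -> meager A.
Proof. by move=> AB [N Nn BN]; exists N => //; exact: subset_trans BN. Qed.

Lemma meager_nowhere N : nowhere_dense N -> meager N.
Proof. by move=> nN; exists (fun=> N) => // x Nx; exists 0. Qed.

Lemma meager0 : meager set0.
Proof. exact/meager_nowhere/nowhere_dense0. Qed.

Lemma meagerU A B : meager A -> meager B -> meager (A `|` B).
Proof.
move=> mA mB; pose C (b : bool) := if b then A else B.
apply: (@meagerS _ (\bigcup_b C b)); last by apply: meager_bigcup => -[].
by move=> x [Ax|Bx]; [exists true|exists false].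
Qed.

Definition restr x n : seq nat := mkseq (fun i => nat_of_ord (x i)) n.

Lemma size_restr x n : size (restr x n) = n.
Proof. exact: size_mkseq. Qed.

Lemma nth_restr x n i : i < n -> nth 0 (restr x n) i = x i.
Proof. exact: nth_mkseq. Qed.

Lemma cyl_restr x n y : cyl (restr x n) y <-> agree n x y.
Proof.
split=> [xy i im|xy i]; last first.
  by rewrite size_restr => im; rewrite xy // nth_restr.
by apply/ord_inj; have := xy i; rewrite size_restr => /(_ im) ->; rewrite nth_restr.
Qed.

Lemma words_restr x n : words K (restr x n).
Proof. by apply/allP => _ /mapP[i _ ->] /=. Qed.

Lemma agreeW m n x y : n <= m -> agree m x y -> agree n x y.
Proof. by move=> nm xy i im; apply/xy/(leq_trans im). Qed.

(** [A] is open relative to the complement of [M]. Its relative boundary [B] is nowhere dense, and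
    outside [M] and [B] it is relatively clopen. *)
Lemma baire_open M A : meager M ->
  (forall x, ~ M x -> A x -> exists n, forall y, ~ M y -> agree n x y -> A y) ->
  baire_prop A.
Proof.
move=> mM oA.
pose B := [set x | [/\ ~ M x, ~ A x &
  forall n, exists y, [/\ ~ M y, agree n x y & A y]]].
have nB : nowhere_dense B.
  move=> w wK.
  have [[x [wx nMx Ax]]|nx] := pselect (exists x, [/\ cyl w x, ~ M x & A x]).
    have [n nP] := oA x nMx Ax.
    exists (drop (size w) (restr x (size w + n))).
      apply/allP => a /mem_drop; apply: (allP (words_restr x _)).
    have -> : w ++ drop (size w) (restr x (size w + n)) = restr x (size w + n).
      rewrite -[RHS](cat_take_drop (size w)); congr (_ ++ _).
      apply: (@eq_from_nth _ 0) => [|i iw].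
        by rewrite size_takel // size_restr leq_addr.
      by rewrite nth_take // nth_restr ?wx // ltn_addr.
    move=> y /cyl_restr xy [nMy nAy _]; apply: nAy; apply: nP => //.
    by apply: agreeW xy; apply: leq_addl.
  exists [::] => // y; rewrite cats0 => wy [nMy _ /(_ (size w))[z [nMz yz Az]]].
  by apply: nx; exists z; split=> // i iw; rewrite yz // wy.
exists (M `|` B); first by apply: meagerU => //; apply: meager_nowhere.
move=> x nMB; have [nMx nBx] : ~ M x /\ ~ B x by split=> ?; apply: nMB; [left|right].
have [Ax|nAx] := pselect (A x).
  have [n nP] := oA x nMx Ax; exists n => y nMBy xy; split=> // _.
  by apply: nP => // My; apply: nMBy; left.
have [n nP] : exists n, forall y, ~ M y -> agree n x y -> ~ A y.
  apply: contrapT => nex; apply: nBx; split=> // n.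
  apply: contrapT => ny; apply: nex; exists n => y nMy xy Ay.
  by apply: ny; exists y.
exists n => y nMBy xy; split=> // Ay; exfalso; apply: (nP y) => // My.
by apply: nMBy; left.
Qed.

Lemma baire_modulo M A A' : baire_prop A -> meager M ->
  (forall x, ~ M x -> (A x <-> A' x)) -> baire_prop A'.
Proof.
move=> [M0 mM0 MA] mM AA'; exists (M0 `|` M); first exact: meagerU.
move=> x nx; have [|n nP] := MA x; first by move=> ?; apply: nx; left.
exists n => y ny xy; rewrite -(AA' x); last by move=> ?; apply: nx; right.
rewrite -(AA' y); last by move=> ?; apply: ny; right.
by apply: nP => // ?; apply: ny; left.
Qed.

Lemma baireC A : baire_prop A -> baire_prop (~` A).
Proof.
move=> [M mM MA]; exists M => // x /MA[n nP]; exists n => y nMy xy.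
by have [yx xy'] := nP y nMy xy; split=> nA Az; apply: nA; [apply: xy'|apply: yx].
Qed.

Lemma baire_bigcup (I : countType) (A : I -> set X) :
  (forall i, baire_prop (A i)) -> baire_prop (\bigcup_i A i).
Proof.
move=> bA; have /choice[M MP] : forall i, exists M, meager M /\
    forall x, ~ M x -> exists n, forall y, ~ M y -> agree n x y -> (A i y <-> A i x).
  by move=> i; have [M] := bA i; exists M.
apply: (@baire_open (\bigcup_i M i)).
  by apply: meager_bigcup => i; case: (MP i).
move=> x nx [i _ Ax]; have [|n nP] := (MP i).2 x.
  by move=> Mx; apply: nx; exists i.
exists n => y ny xy; exists i => //; apply/nP => // My.
by apply: ny; exists i.
Qed.

Lemma baireU A B : baire_prop A -> baire_prop B -> baire_prop (A `|` B).
Proof.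
move=> bA bB; pose C (b : bool) := if b then A else B.
have -> : A `|` B = \bigcup_b C b.
  apply/seteqP; split=> [x [Ax|Bx]|x [[] _ ?]]; [by exists true|by exists false|by left|by right].
by apply: baire_bigcup => -[].
Qed.

Lemma baireI A B : baire_prop A -> baire_prop B -> baire_prop (A `&` B).
Proof.
by move=> /baireC bA /baireC bB; rewrite -[_ `&` _]setCK setCI; apply/baireC/baireU.
Qed.

Lemma baire_bigcap (I : countType) (A : I -> set X) :
  (forall i, baire_prop (A i)) -> baire_prop (\bigcap_i A i).
Proof.
move=> bA; rewrite -[\bigcap_i _]setCK setC_bigcap; apply/baireC/baire_bigcup.
by move=> i; apply: baireC.
Qed.

Lemma baire_clopen A : (forall x, A x -> exists n, forall y, agree n x y -> A y) ->
  baire_prop A.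
Proof.
move=> oA; apply: (baire_open meager0) => x _ /oA[n nP].
by exists n => y _; apply: nP.
Qed.

(** [B s] collects the points with a branch through [s]. Up to a meager set, the result of the
    operation is the complement of the open set [G [::]]. *)
Lemma baire_suslin (A : seq nat -> set X) : (forall s, baire_prop (A s)) ->
  baire_prop (suslin_op A).
Proof.
move=> bA.
pose B s : set X := [set x | exists2 u : nat -> nat, mkseq u (size s) = s &
  forall n, A (mkseq u n) x].
have BA s : B s `<=` A s by move=> x [u us /(_ (size s))]; rewrite us.
have BS s x : B s x -> exists k, B (rcons s k) x.
  move=> [u us uA]; exists (u (size s)), u => //.
  by rewrite size_rcons mkseqS us.
(* G s is the largest open set in which B s is meager, so that ~` G s is,
   modulo a meager set, the smallest set with the Baire property above B s. *)
pose G s : set X := [set x | exists n, meager (B s `&` agree n x)].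
have bG s : baire_prop (G s).
  apply: baire_clopen => x [n mB]; exists n => y xy; exists n.
  apply: meagerS mB => z [Bz yz]; split=> // i im.
  by rewrite yz // xy.
(* [G s] is covered by the cylinders in which [B s] is meager, and there are only countably many
   cylinders. *)
have mBG s : meager (B s `&` G s).
  pose N (w : seq nat) := [set x | meager (B s `&` cyl w) /\ (B s `&` cyl w) x].
  apply: (@meagerS _ (\bigcup_w N w)).
    move=> x [Bx [n mB]]; have cE : cyl (restr x n) = agree n x.
      by apply/seteqP; split=> y /cyl_restr.
    by exists (restr x n) => //; split; rewrite cE.
  apply: meager_bigcup => w.
  have [mw|nw] := pselect (meager (B s `&` cyl w)).
    by apply: meagerS mw => x [].
  by apply: meagerS meager0 => x [].
pose E s := ~` G s `&` (~` A s `|` \bigcap_k G (rcons s k)).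
(* [E s] is relatively open off a meager set [M]. Near a point of [E s] off [M], [B s] is covered by
   [M] and the meager parts of the [B (rcons s k)] in [G (rcons s k)], which would put the point in
   [G s]. *)
have mE s : meager (E s).
  have : baire_prop (E s).
    apply: baireI; first exact/baireC/bG.
    apply: baireU; first exact/baireC/bA.
    by apply: baire_bigcap => k; apply: bG.
  move=> [M mM ME]; apply: (meagerS _ mM) => x Ex; apply: contrapT => nMx.
  have [n nP] := ME x nMx; case: (Ex) => nGx _; apply: nGx; exists n.
  apply: (@meagerS _ (M `|` \bigcup_k (B (rcons s k) `&` G (rcons s k)))).
    move=> y [By xy]; have [My|nMy] := pselect (M y); first by left.
    have [k Bk] := BS _ _ By; right; exists k => //; split=> //.
    by have /(nP y nMy xy)[_ [|/(_ k)]] := Ex; [case; apply: BA|apply].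
  by apply: meagerU => //; apply: meager_bigcup.
apply: (@baire_modulo (\bigcup_s (E s `|` (B s `&` G s))) (~` G [::])).
- exact/baireC/bG.
- by apply: meager_bigcup => s; apply: meagerU.
move=> x nx; have [nEx nBGx] : (forall s, ~ E s x) /\ (forall s, ~ (B s `&` G s) x).
  by split=> s ?; apply: nx; exists s => //; [left|right].
split=> [nGx|[u _ uA] Gx]; last first.
  by apply: (nBGx [::]); split=> //; exists u => // n; apply: uA.
(* Outside every [E s], leaving [G s] means lying in [A s] and leaving some [G (rcons s k)];
   iterated from [[::]], this builds a branch. The index 0 is a default when [x] is in [G s]. *)
have /choice[f fP] s : exists k, ~ G s x -> A s x /\ ~ G (rcons s k) x.
  have [Gs|nGs] := pselect (G s x); first by exists 0.
  have /not_andP[//|/not_orP[/contrapT As nG]] := nEx s.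
  apply: contrapT => nk; apply: nG => k _; apply: contrapT => nGk.
  by apply: nk; exists k.
pose S := fix S n := if n is n'.+1 then rcons (S n') (f (S n')) else [::].
have nGS n : ~ G (S n) x by elim: n => //= n /fP[].
have SE n : mkseq (f \o S) n = S n by elim: n => // n IHn; rewrite mkseqS IHn.
exists (f \o S) => // n _; rewrite SE.
by have [] := fP _ (nGS n).
Qed.

Lemma sigma_algebra_baire : sigma_algebra setT baire_prop.
Proof.
split; first by apply: baire_clopen.
  by move=> A bA; rewrite setTD; apply: baireC.
by move=> A bA; apply: baire_bigcup.
Qed.

End Baire.

(** * Blocks whose instances avoid a meager set *)

Section Avoid.
Variable K : nat.
Local Notation X := (nat -> 'I_K).

(* y is the concatenation of the blocks v m, with some letters of K
   substituted for their variables. *)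
Definition follows (v : nat -> seq nat * seq nat) (y : X) := forall m,
  exists z, [/\ words K z, size z = m & cyl (inst K v z ++ (v m).1) y].

Lemma cyl_cat w w' (y : X) : cyl (w ++ w') y -> cyl w y.
Proof.
move=> ww' i iw; rewrite ww' ?size_cat ?ltn_addr //.
by rewrite nth_cat iw.
Qed.

(** [v] is lengthened once for each word of [P]; later extensions only shrink the cylinders already
    made disjoint from [N]. *)
Lemma avoid_step (N : set X) (P : seq (seq nat)) u0 : nowhere_dense N ->
  (forall u, u \in P -> words K u) -> words K u0 ->
  exists v, [/\ words K v, exists t, v = u0 ++ t &
    forall u, u \in P -> forall y, cyl (u ++ v) y -> ~ N y].
Proof.
move=> nN; elim: P => [|u P IHP] PK u0K.
  by exists u0; split=> //; exists [::]; rewrite cats0.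
have [v [vK [t vE] vP]] : exists v, [/\ words K v, exists t, v = u0 ++ t &
    forall u, u \in P -> forall y, cyl (u ++ v) y -> ~ N y].
  by apply: IHP => // u' u'P; apply: PK; rewrite inE u'P orbT.
have uK := PK u (mem_head _ _).
have [w' w'K w'P] := nN _ (words_cat uK vK).
exists (v ++ w'); split; first exact: words_cat.
  by exists (t ++ w'); rewrite vE catA.
move=> u'; rewrite inE => /orP[/eqP -> y|u'P y]; rewrite catA.
  exact: w'P.
by move=> /cyl_cat; apply: vP.
Qed.

(** Block [m] is chosen against [N m], simultaneously for the finitely many instances of the
    preceding blocks. *)
Lemma avoid (N : nat -> set X) u0 : (forall i, nowhere_dense (N i)) ->
  words K u0 -> exists v : nat -> seq nat,
  [/\ forall m, words K (v m), exists t, v 0 = u0 ++ t &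
      forall y, follows (fun m => (v m, [::])) y -> forall i, ~ N i y].
Proof.
move=> nN u0K.
have step (mP : nat * seq (seq nat)) : exists v,
    (forall u, u \in mP.2 -> words K u) -> [/\ words K v,
      mP.1 = 0 -> exists t, v = u0 ++ t &
      forall u, u \in mP.2 -> forall y, cyl (u ++ v) y -> ~ N mP.1 y].
  case: mP => m P /=.
  have [PK|nPK] := pselect (forall u, u \in P -> words K u); last by exists [::].
  by have [v [vK vE vP]] := avoid_step (nN m) PK u0K; exists v.
have [f fP] := choice step.
pose ext P v := [seq u ++ block K b (v, [::]) | u <- P, b <- iota 0 K].
pose Ps := fix Ps m := if m is m'.+1 then ext (Ps m') (f (m', Ps m')) else [:: [::]].
pose v m := f (m, Ps m).
have PK m u : u \in Ps m -> words K u.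
  elim: m u => [|m IHm] u /=; first by rewrite inE => /eqP ->.
  move=> /allpairsP[[u' b] [/IHm u'K]]; rewrite mem_iota => /andP[_ bK] ->.
  apply: words_cat => //; apply: subst_words => //.
  apply: words_cat => /=; last by rewrite /words /= ltnSn.
  by have [/wordsS] := fP (m, Ps m) IHm.
exists v; split; first by move=> m; have [] := fP (m, Ps m) (PK m).
  by have [_ + _] := fP (0, Ps 0) (PK 0); apply.
have instP z : words K z -> inst K (fun m => (v m, [::])) z \in Ps (size z).
  elim/last_ind: z => [|z b IHz] //.
  rewrite /words /= all_rcons => /andP[bK wz].
  rewrite inst_rcons size_rcons /=; apply/allpairsP.
  exists (inst K (fun m => (v m, [::])) z, b) => /=; split=> //; first exact: IHz.
  by rewrite mem_iota.
move=> y yv i; have [z [zK zi yz]] := yv i.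
have [_ _] := fP (i, Ps i) (PK i); apply; last exact: yz.
by rewrite -zi; apply: instP.
Qed.

(** A first use of [avoid] yields a point [x] off the exceptional meager set, near which the colour
    is constant off that set. A second one starts its blocks with an initial part of [x]. *)
Lemma baire_coloring (l : nat) (G : X -> 'I_l) :
  (forall a, baire_prop (G @^-1` [set a])) ->
  (forall v, (forall m, words K (v m)) ->
     exists y, follows (fun m => (v m, [::])) y) ->
  exists (v : nat -> seq nat) a, (forall m, words K (v m)) /\
    forall y, follows (fun m => (v m, [::])) y -> G y = a.
Proof.
move=> bG exf.
have /choice[M MP] : forall a, exists M : set X, meager M /\ forall x, ~ M x ->
    exists n, forall y, ~ M y -> agree n x y -> (G y = a <-> G x = a).
  by move=> a; have [M] := bG a; exists M.
have [N nN MN] : meager (\bigcup_a M a).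
  by apply: meager_bigcup => a; case: (MP a).
have [v0 [v0K _ v0P]] := avoid nN (isT : words K [::]).
have [x /v0P xN] := exf v0 v0K.
have avM y a : (forall i, ~ N i y) -> ~ M a y.
  by move=> yN My; have [|i _] := MN y; [exists a|exact: yN].
have [n nP] := (MP (G x)).2 x (avM _ _ xN).
have [v [vK [t v0E] vP]] := avoid nN (words_restr x n).
exists v, (G x); split=> // y yv.
apply/(nP y _ _).2 => //; first exact/avM/vP.
have [z [_ /size0nil -> /=]] := yv 0.
by rewrite v0E => /cyl_cat/cyl_restr.
Qed.

End Avoid.

(** * Elements with a given stem as a Cantor space *)

Section Extension.
Variables (K : nat) (w j : seq nat).
Hypothesis st : stem K w j.
Local Notation X := (nat -> 'I_K).

Definition extends (f : rigid nat 'I_K) (w j : seq nat) :=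
  (forall i, i < size w -> rsurj f i = nth 0 w i :> nat) /\
  (forall x : 'I_K, rsect f x = nth 0 j x).

(** [y 0] is only the default of [insubd], as the letters of a stem are below [K]. *)
Definition glue_surj (y : X) i : 'I_K :=
  if i < size w then insubd (y 0) (nth 0 w i) else y (i - size w).

Lemma glue_surjE y i : i < size w -> glue_surj y i = nth 0 w i :> nat.
Proof.
move=> iw; rewrite /glue_surj iw val_insubd.
have /allP wK := stem_words st.
by have /= -> := wK _ (mem_nth 0 iw).
Qed.

Lemma glue_surjK y (x : 'I_K) : glue_surj y (nth 0 j x) = x.
Proof.
have [jx wjx _] := stem_marks st (ltn_ord x).
by apply/ord_inj; rewrite glue_surjE.
Qed.

Lemma glue_surj_le y (x : 'I_K) i :
  (i <= nth 0 j x)%O -> (glue_surj y i <= x)%O.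
Proof.
suff H : i <= nth 0 j x -> (glue_surj y i : nat) <= x by [].
have [jx _ le] := stem_marks st (ltn_ord x) => ij.
by rewrite glue_surjE; [apply: le|apply: leq_ltn_trans jx].
Qed.

Definition glue y : rigid nat 'I_K := mk_rigid (glue_surjK y) (@glue_surj_le y).

Lemma glue_extends y : extends (glue y) w j.
Proof. by split=> // i iw; apply: glue_surjE. Qed.

Definition tail (f : rigid nat 'I_K) : X := fun i => rsurj f (size w + i).

Lemma extends_glue f : extends f w j -> f = glue (tail f).
Proof.
move=> [rf cf]; apply: rigid_ext => // i.
have [iw|wi] := ltnP i (size w).
  by apply/ord_inj; rewrite /= rf // glue_surjE.
by rewrite /= /glue_surj ltnNge wi /= /tail subnKC.
Qed.

Lemma extends_fixes f e : extends f w j -> fixes (size w) e ->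
  extends (rcomp f e) w j.
Proof.
move=> [rf cf] fe; split=> [i iw|x] /=; first by have [-> _] := fe i iw; apply: rf.
have [jx _ _] := stem_marks st (ltn_ord x).
by rewrite cf; have [_ ->] := fe _ jx.
Qed.

Lemma extends_act f h : extends f w j ->
  extends (rcomp f h) (act h (w, j)).1 (act h (w, j)).2.
Proof.
move=> [rf cf]; split=> [i|x] /=.
  by rewrite size_mkseq => il; rewrite nth_mkseq // rf // len_rsurj.
by rewrite cf (nth_map 0) // (stem_size st).
Qed.

(** [build_decode] with [rsurj f] as decoding: the letters substituted in the blocks are those that
    [f] gives to the new variables. *)
Lemma follows_tail v f
    (wv : forall m, words K.+1 (v m, [::] : seq nat).1 /\
                    words K.+1 (v m, [::] : seq nat).2) :
  (forall m, words K (v m)) -> extends f w j ->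
  follows (fun m => (v m, [::])) (tail (rcomp f (build st wv))).
Proof.
move=> vK [rf cf] m.
exists (mkseq (fun i => nat_of_ord (rsurj f (size w + i))) m); split.
- by apply/allP => _ /mapP[i _ ->] /=.
- by rewrite size_mkseq.
rewrite -(@build_decode K w j _ wv (fun i => nat_of_ord (rsurj f i))).
- by move=> i; rewrite size_mkseq => im; rewrite nth_mkseq.
- by move=> x xK; rewrite -[x]/(val (Ordinal xK)) -cf rsectK.
- by move=> i im; rewrite nth_mkseq.
- by rewrite size_mkseq.
- by left; apply: vK.
Qed.

(** The map is continuous, and the sets whose preimage has the property of Baire form a
    sigma-algebra closed under the Suslin operation. *)
Lemma baire_preimage h (S : set (rigid nat 'I_K)) : suslin_sigma S ->
  baire_prop ((fun y => rcomp (glue y) h) @^-1` S).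
Proof.
set phi := fun y => rcomp (glue y) h.
apply: (@smallest_sub _ _ _ [set S | baire_prop (phi @^-1` S)]).
  have [b0 bC bU] := @sigma_algebra_baire K.
  split; last by move=> A bA; apply: (baire_suslin (A := fun s => phi @^-1` A s)).
  split=> [|A /bC|A /bU] /=; first by rewrite preimage_set0.
    by rewrite !setTD preimage_setC.
  by rewrite preimage_bigcup.
move=> C clC; rewrite /= -[C]setCK preimage_setC; apply: baireC.
apply: baire_clopen => y.
have /rigid_openE oC : open (~` C) by apply: closed_openC.
(* The marks of [phi y] do not depend on [y], and as [rsurj h i <= i], its letters before [L] depend
   only on [y] below [L.+1], which also covers the default [y 0]. *)
move=> /(oC (phi y))[L [t [[rt ct] tC]]]; exists L.+1 => y' yy'.
apply: tC; split=> [i|x]; last exact: ct.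
rewrite -rt /= /glue_surj yy' //; case: ltnP => // _.
rewrite yy' // ltnS (leq_trans (leq_subr _ _)) //.
exact: leq_trans (rsurj_leq_id _ _) (ltnW (ltn_ord i)).
Qed.

End Extension.

(** * Reduction of a Suslin measurable colouring to stems *)

Lemma rigid_stem K (f : rigid nat 'I_K.+1) :
  exists w j, stem K.+1 w j /\ extends f w j.
Proof.
pose s i := nat_of_ord (rsurj f i); pose c i := rsect f (inord i : 'I_K.+1).
pose L k := if k is k'.+1 then (c k').+1 else 0.
have c_mono x y : x < y -> y <= K -> c x < c y.
  move=> xy yK; apply: (@rsect_homo _ _ _ _ f (inord x) (inord y)).
  by rewrite Order.OrdinalOrder.ltEord !inordK // ltnS ltnW // (leq_trans xy).
have sc k : k <= K -> s (c k) = k by move=> kK; rewrite /s rsectK inordK.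
have sle k y : k <= K -> y <= c k -> s y <= k.
  move=> kK yc; rewrite -[X in _ <= X](@inordK K k) //.
  exact: (@rsurj_le _ _ _ _ f (inord k) y).
(* Cutting [f] just after its mark of [k - 1] gives a [k]-stem; the letters up to the mark of [k]
   are at most [k]. *)
have st k : k <= K.+1 -> stem k (mkseq s (L k)) (mkseq c k).
  elim: k => [|k IHk] kK //.
  have Lk : L k <= c k by case: (k) kK => // k' kK; apply: c_mono.
  exists (mkseq s (L k)), (mkseq (fun i => s (L k + i)) (c k - L k)), (mkseq c k).
  split; first exact/IHk/ltnW.
  - apply/allP => _ /mapP[i + ->]; rewrite mem_iota add0n /= => ic.
    by rewrite ltnS; apply: sle => //; apply: ltnW; rewrite -ltn_subRL.
  - by have := mkseqD s (L k) (c k - L k); rewrite addnS subnKC // sc.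
  - by rewrite !size_mkseq subnKC // mkseqS.
exists (mkseq s (L K.+1)), (mkseq c K.+1); split; first exact: st.
split=> [i|x]; first by rewrite size_mkseq => iL; rewrite nth_mkseq.
by rewrite nth_mkseq // /c inord_val.
Qed.

Theorem theorem6 (K l : nat) (hl : (0 < l)%N) (g : rigid nat 'I_K -> 'I_l)
    (hg : suslin_measurable g) :
  exists rc : rigid nat nat, monochromatic g (pullbacks rc K).
Proof.
case: K g hg => [|K] g hg.
  (* For [K = 0] there is nothing to colour: [rsurj f 0] would be an element of ['I_0]. *)
  by exists id_rigid, (Ordinal hl) => f; case: (rsurj f 0).
pose R h w j := exists a, forall f, extends f w j -> g (rcomp f h) = a.
have [||h hP] := @stem_fusion K.+1 R.
- move=> h e w j [a ha] fe st; exists a => f fw; rewrite rcompA ha //.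
  exact: extends_fixes.
- have wv (v : nat -> seq nat) : (forall m, words K.+1 (v m)) -> forall m,
      words K.+2 (v m, [::] : seq nat).1 /\ words K.+2 (v m, [::] : seq nat).2.
    by move=> vK m; split; first exact/wordsS/vK.
  move=> h w j st; pose G y := g (rcomp (glue st y) h).
  have [|v vK|v [a [vK va]]] := @baire_coloring K.+1 l G.
  + by move=> a; apply: (baire_preimage st h (hg [set a])).
  (* Any extension of the stem, here by zeros, composed with [build] has a tail that follows the
     blocks. *)
  + exists (tail w (rcomp (glue st (fun=> ord0)) (build st (wv v vK)))).
    exact/follows_tail/glue_extends.
  + exists (build st (wv v vK)); first exact: fixes_build.
    exists a => f fw; rewrite rcompA.
    rewrite (extends_glue st (extends_fixes st fw (fixes_build st (wv v vK)))).
    by apply: va; apply: follows_tail.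
(* After composition with [h] the colour depends on the stem alone, which defines a colouring of
   stems; other pairs get the default colour 0. *)
have /choice[gam gamP] : forall s : seq nat * seq nat, exists a,
    stem K.+1 s.1 s.2 -> forall f, extends f s.1 s.2 -> g (rcomp f h) = a.
  move=> [w j]; have [st|nst] := pselect (stem K.+1 w j).
    by have [a ha] := hP w j st; exists a.
  by exists (Ordinal hl).
have [h' [a aP]] := stem_ramsey K.+1 gam.
exists (rcomp h' h), a => _ [f _ <-].
have [w [j [st fw]]] := rigid_stem f.
rewrite -(aP w j st) rcompA; apply: gamP; first exact: stem_act.
exact: extends_act.
Qed.
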